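(* There is an absolute constant $c>0$ such that the following holds. Let $G$ be a simple undirected graph presented as a stream of $m$ distinct edges $e_1,\dots,e_m$, with $W$ wedges and $T\ge 1$ triangles, and let $\kappa = 3T/W$. Assume $W \ge m$ and fix $\beta\in(0,1)$. Run the algorithm Single-Bit with a reservoir of $s$ slots, where $s \ge c\,m/(\beta^3\sqrt{T})$, and let $b_m$ be its output bit at the final time $m$ and $\mathcal{W}_m$ its wedge multiset at time $m$. Set $est = m^2|\mathcal{W}_m|/(s(s-1))$. Then $|\kappa/3 - \mathbf{E}[b_m]| < \beta$, and with probability greater than $1-\beta$, $|W - est| < \beta W$.
   Context: A wedge in a graph is a path of length 2, i.e. an unordered pair of distinct edges sharing exactly one vertex; $W$ is the number of wedges of $G$. A wedge is closed if the edge joining its two non-shared endpoints is in the graph. $G_t$ is the graph on edges $\{e_1,\dots,e_t\}$. Algorithm Single-Bit (with reservoir size $s$): it maintains a reservoir $\mathcal{R}_t=(r_1,\dots,r_s)$ of $s$ edge slots. At each time $t=1,\dots,m$, each slot of $\mathcal{R}_{t-1}$ is independently replaced by $e_t$ with probability $1/t$, giving $\mathcal{R}_t$ (so at $t=1$ all slots hold $e_1$). $\mathcal{W}_t$ is the multiset of wedges $\{r_i,r_j\}$, $i<j$, formed by pairs of slots of $\mathcal{R}_t$ (one element per slot pair forming a wedge). $\mathcal{D}_t$ is the set of elements of $\mathcal{W}_t$ closed by $e_t$ (i.e. $e_t$ joins the two non-shared endpoints). With $\mathcal{C}_0=\emptyset$, set $\mathcal{C}_t = (\mathcal{C}_{t-1}\cap\mathcal{W}_t)\cup\mathcal{D}_t$.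 If $\mathcal{W}_t$ is empty, output $b_t=0$; otherwise pick a uniformly random element of $\mathcal{W}_t$ and output $b_t=1$ if it lies in $\mathcal{C}_t$ and $b_t=0$ otherwise. The expectation is over the randomness of the algorithm; the stream order is arbitrary but fixed. *)

(* Defs.v *)
From HB Require Import structures.
From mathcomp Require Import all_boot all_order all_algebra.
Set Implicit Arguments. Unset Strict Implicit. Unset Printing Implicit Defensive.
Import Order.TTheory GRing.Theory Num.Theory.

(* Edges of a simple graph on vertex type V are 2-element vertex sets.
   The stream is a sequence es = [:: e_1; ...; e_m] of edges. *)
Section Defs.
Variable V : finType.
Implicit Types (es : seq {set V}) (e f g : {set V}).

Definition is_wedge e f : bool := (e != f) && (#|e :&: f| == 1%N).

Definition closes g e f : bool := g == (e :|: f) :\: (e :&: f).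

Definition nwedges es : nat :=
  #|[set P : {set {set V}} | [exists e : {set V}, exists f : {set V},
      [&& e \in es, f \in es, is_wedge e f & P == [set e; f]]]]|.

Definition ntri es : nat :=
  #|[set S : {set V} | (#|S| == 3%N) &&
      [forall e : {set V}, ((e \subset S) && (#|e| == 2%N)) ==> (e \in es)]]|.

(* Randomness of the reservoir: flips (t, i) = true iff at time t+1 (0-based t)
   slot i is replaced by e_(t+1). *)
Variable s m : nat.
Definition flips := {ffun 'I_m * 'I_s -> bool}.

Definition flip_at (fl : flips) (t : nat) (i : 'I_s) : bool :=
  [exists x : 'I_m, (val x == t) && fl (x, i)].

(* reservoir content of slot i at time t (t = 0 is the initial dummy state,
   which is always overwritten at time 1 since the replacement probability is 1) *)
Fixpoint res es (fl : flips) (t : nat) (i : 'I_s) : {set V} :=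
  match t with
  | 0 => nth set0 es 0
  | t'.+1 => if flip_at fl t' i then nth set0 es t' else res es fl t' i
  end.

(* W_t : multiset of wedges, indexed by slot pairs (i, j) with i < j *)
Definition Wset es (fl : flips) (t : nat) : {set 'I_s * 'I_s} :=
  [set p : 'I_s * 'I_s | (val p.1 < val p.2)%N && is_wedge (res es fl t p.1) (res es fl t p.2)].

(* C_t, with C_0 = empty; an element of W_(t-1) is the same element of W_t iff
   it has the same slot pair and the same wedge (both slots unchanged);
   D_t = elements of W_t closed by e_t *)
Fixpoint Cset es (fl : flips) (t : nat) : {set 'I_s * 'I_s} :=
  match t with
  | 0 => set0
  | t'.+1 =>
    [set p in Wset es fl t'.+1 |
       [&& p \in Cset es fl t',
           res es fl t' p.1 == res es fl t'.+1 p.1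
         & res es fl t' p.2 == res es fl t'.+1 p.2]
       || closes (nth set0 es t') (res es fl t'.+1 p.1) (res es fl t'.+1 p.2)]
  end.

Variable R : rcfType.
Local Open Scope ring_scope.

Definition weight (fl : flips) : R :=
  \prod_(t < m) \prod_(i < s)
     (if fl (t, i) then (t.+1)%:R^-1 else 1 - (t.+1)%:R^-1).

(* E[b_m]: the final bit is 1 iff a uniformly random element of W_m lies in C_m
   (b_m = 0 if W_m is empty) *)
Definition expect_bm es : R :=
  \sum_(fl : flips) weight fl *
    (if Wset es fl m == set0 then 0
     else \sum_(p in Wset es fl m) (#|Wset es fl m|%:R)^-1 *
                                   (if p \in Cset es fl m then 1 else 0)).

Definition est es (fl : flips) : R :=
  (m ^ 2)%:R * (#|Wset es fl m|)%:R / ((s * (s - 1))%:R).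

Definition prob (E : pred flips) : R := \sum_(fl : flips | E fl) weight fl.

End Defs.

(* Main.v *)
Require Import Defs.
From mathcomp Require Import all_boot all_order all_algebra.
From mathcomp Require Import ring lra zify.
Set Implicit Arguments. Unset Strict Implicit. Unset Printing Implicit Defensive.
Import Order.TTheory GRing.Theory Num.Theory.
Local Open Scope ring_scope.

(* At time m the slots hold independent uniform edges X_i of the stream. Since an
   edge kept until time m is present at every later time, a wedge of two slots lies
   in C_m iff some later edge closes it; each triangle has exactly one such wedge,
   formed by its two earliest edges. Hence Y = |W_m| and Z = |C_m| count the slot
   pairs hitting a relation with 2W, resp. 2T, of the m^2 ordered pairs of edges,
   and E Z / E Y = T / W.
   An edge lies in d wedges with d^2 <= 8W, because the edges at each of its
   endpoints form a clique of the wedge relation. This bounds the covariance of two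
   slot pairs that overlap, so Var Y <= E Y (1 + 16 s sqrt W / m), which is at most
   (beta^3 / 4) (E Y)^2 for s as large as assumed. Chebyshev's inequality gives the
   estimate of W, and Z <= Y gives |E (Z / Y) - E Z / E Y| <= E |Y - E Y| / E Y. *)

(** * Averages over uniform samples *)

Section Average.
Variables (R : realFieldType) (I T : finType).
Implicit Types (X : {ffun I -> T}) (F G H : {ffun I -> T} -> R).

Definition avg F : R := (\sum_X F X) / #|{ffun I -> T}|%:R.

Definition upd X (i : I) (a : T) : {ffun I -> T} :=
  [ffun j => if j == i then a else X j].

Lemma updE X i a j : upd X i a j = if j == i then a else X j.
Proof. exact: ffunE. Qed.

Lemma eq_avg F G : F =1 G -> avg F = avg G.
Proof. by move=> eqFG; rewrite /avg (eq_bigr G). Qed.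

Lemma avgD F G : avg (fun X => F X + G X) = avg F + avg G.
Proof. by rewrite /avg big_split mulrDl. Qed.

Lemma avgZ k F : avg (fun X => k * F X) = k * avg F.
Proof. by rewrite /avg -mulr_sumr mulrA. Qed.

Lemma avgB F G : avg (fun X => F X - G X) = avg F - avg G.
Proof. by rewrite /avg sumrB mulrBl. Qed.

Lemma avg_sum (J : finType) (P : pred J) (F : J -> {ffun I -> T} -> R) :
  avg (fun X => \sum_(j | P j) F j X) = \sum_(j | P j) avg (F j).
Proof. by rewrite /avg exchange_big mulr_suml. Qed.

Lemma le_avg F G : (forall X, F X <= G X) -> avg F <= avg G.
Proof.
by move=> leFG; rewrite /avg ler_wpM2r ?invr_ge0 ?ler0n // ler_sum.
Qed.

Hypothesis T_gt0 : (0 < #|T|)%N.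

Lemma avg_const k : avg (fun=> k) = k.
Proof.
rewrite /avg sumr_const -[_ *+ _]mulr_natr mulfK // pnatr_eq0 card_ffun.
by rewrite expn_eq0 -leqn0 leqNgt T_gt0.
Qed.

Lemma norm_avg_le F : `|avg F| <= avg (fun X => `|F X|).
Proof.
rewrite /avg normrM [X in _ * X]ger0_norm ?invr_ge0 ?ler0n //.
by rewrite ler_wpM2r ?invr_ge0 ?ler0n // ler_norm_sum.
Qed.

(* (X, a) |-> (upd X i a, X i) is an involution. *)
Lemma avg_resample i F :
  avg F = avg (fun X => (\sum_a F (upd X i a)) / #|T|%:R).
Proof.
rewrite /avg -mulr_suml; congr (_ / _).
pose sw (Xa : {ffun I -> T} * T) := (upd Xa.1 i Xa.2, Xa.1 i).
have swK : involutive sw.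
  case=> X a; rewrite /sw /=; congr (_, _); last by rewrite updE eqxx.
  by apply/ffunP => j; rewrite !updE; case: eqP => // ->.
apply: (canRL (mulfK _)); first by rewrite pnatr_eq0 -lt0n.
rewrite pair_bigA /= (reindex_inj (can_inj swK)) /=.
rewrite -(pair_bigA _ (fun X a => F (upd (upd X i a) i (X i)))) /= mulr_suml.
apply: eq_bigr => X _; rewrite (eq_bigr (fun=> F X)).
  by rewrite sumr_const mulr_natr.
move=> a _; congr F; apply/ffunP => j; rewrite !updE.
by case: eqP => // ->.
Qed.

(** Chebyshev: at every sample the indicator is at most [F X ^+ 2 / b ^+ 2]. *)
Lemma second_moment_tail F (b : R) : 0 < b ->
  avg (fun X => (b <= `|F X|)%R%:R) <= avg (fun X => F X ^+ 2 : R) / b ^+ 2.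
Proof.
move=> b0; rewrite mulrC -avgZ; apply: le_avg => X.
rewrite -(real_normK (num_real (F X))).
have b2 : 0 < b ^+ 2 by rewrite exprn_gt0.
rewrite mulrC ler_pdivlMr //; case: (lerP b `|F X|) => /= [h|_].
  by rewrite mul1r; move: (normr_ge0 (F X)) h b0; nra.
by rewrite mul0r exprn_ge0 ?normr_ge0.
Qed.

(** Pointwise AM-GM; the free parameter [b] replaces the square root that Cauchy-Schwarz would bring
    in. *)
Lemma avg_norm_le F (b : R) : 0 < b ->
  avg (fun X => `|F X|) <= (avg (fun X => F X ^+ 2 : R) / b + b) / 2.
Proof.
move=> b0; rewrite -[X in _ + X]avg_const mulrC -[_ / b]mulrC -avgZ -avgD -avgZ.
apply: le_avg => X; rewrite -(real_normK (num_real (F X))).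
have -> : 2^-1 * (b^-1 * `|F X| ^+ 2 + b) = (`|F X| ^+ 2 + b ^+ 2) / (2 * b).
  by field; rewrite gt_eqF.
rewrite ler_pdivlMr ?mulr_gt0 //.
have := sqr_ge0 (`|F X| - b); nra.
Qed.

End Average.

(** * Mean and variance of the number of related slot pairs *)

Section PairCount.
Variables (R : realFieldType) (s : nat) (T : finType).
Hypothesis T_gt0 : (0 < #|T|)%N.
Implicit Types (X : {ffun 'I_s -> T}) (h : rel T) (H : {ffun 'I_s -> T} -> R).

(** The probability that two independent uniform samples are related. Ordered pairs are counted,
    diagonal included. *)
Definition edge_density h : R :=
  #|[set ab : T * T | h ab.1 ab.2]|%:R / #|T|%:R ^+ 2.

Definition hit_pairs h X : {set 'I_s * 'I_s} :=
  [set p : 'I_s * 'I_s | (p.1 < p.2)%N && h (X p.1) (X p.2)].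

Let P : pred ('I_s * 'I_s) := fun p => (p.1 < p.2)%N.
Let N := #|[set p : 'I_s * 'I_s | (p.1 < p.2)%N]|.
Let n : R := #|T|%:R.

Let n_neq0 : n != 0. Proof. by rewrite pnatr_eq0 -lt0n. Qed.

Lemma card_hit_pairs h X :
  #|hit_pairs h X|%:R = \sum_(p : 'I_s * 'I_s | (p.1 < p.2)%N) (h (X p.1) (X p.2))%:R :> R.
Proof.
rewrite -sum1_card natr_sum big_mkcond [RHS]big_mkcond /=.
by apply: eq_bigr => p _; rewrite inE; case: leqP => //=; case: (h _ _).
Qed.

Lemma edge_densityE h :
  edge_density h = (\sum_(ab : T * T) (h ab.1 ab.2)%:R) / n ^+ 2.
Proof.
rewrite /edge_density -sum1_card natr_sum big_mkcond; congr (_ / _).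
by apply: eq_bigr => ab _; rewrite inE; case: (h _ _).
Qed.

(** [H] ignores both slots, so resampling them one after the other leaves the proportion of related
    values as a constant factor. *)
Lemma avg_pair h i j H : i != j ->
    (forall X a, H (upd X i a) = H X) -> (forall X a, H (upd X j a) = H X) ->
  avg (fun X => (h (X i) (X j))%:R * H X) = edge_density h * avg H.
Proof.
move=> ij Hi Hj; rewrite (avg_resample T_gt0 j) (avg_resample T_gt0 i) -avgZ.
apply: eq_avg => X; rewrite edge_densityE.
under eq_bigr => a _ do
  under eq_bigr => b _ do rewrite Hj Hi !updE eqxx (negPf ij) eqxx.
under eq_bigr => a _ do rewrite -mulr_suml.
by rewrite -!mulr_suml pair_bigA /= -/n; field.
Qed.

(** Here [H] may depend on slot [i], so only slot [j] is resampled: whatever value slot [i] has, at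
    most [K] of the [n] values are related to it. *)
Lemma avg_pair_le h i j H (K : R) : i != j ->
    (forall X, 0 <= H X) -> (forall X a, H (upd X j a) = H X) ->
    (forall x, #|[set y | h x y]|%:R <= K) ->
  avg (fun X => (h (X i) (X j))%:R * H X) <= K / n * avg H.
Proof.
move=> ij H0 Hj leK; rewrite (avg_resample T_gt0 j) -avgZ.
apply: le_avg => X.
under eq_bigr => b _ do rewrite Hj !updE eqxx (negPf ij).
rewrite -mulr_suml mulrAC ler_wpM2r // ler_wpM2r ?invr_ge0 ?ler0n //.
apply: le_trans (leK (X i)); rewrite -sum1_card natr_sum [leRHS]big_mkcond.
by apply: ler_sum => b _; rewrite inE; case: (h _ _).
Qed.

Lemma avg_hit_pairs h :
  avg (fun X => #|hit_pairs h X|%:R) = N%:R * edge_density h :> R.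
Proof.
under eq_avg => X do rewrite card_hit_pairs.
rewrite avg_sum (eq_bigr (fun=> edge_density h)).
  by rewrite sumr_const -cardsE mulrC mulr_natr.
move=> [i j] /= ij; rewrite -[RHS]mulr1 -[X in _ * X](@avg_const R 'I_s T T_gt0).
rewrite -(@avg_pair h i j) //; last by rewrite neq_ltn ij.
by apply: eq_avg => X; rewrite mulr1.
Qed.

Lemma edge_density_ge0 h : 0 <= edge_density h.
Proof. by rewrite divr_ge0 ?exprn_ge0 ?ler0n. Qed.

(* A pair [q] disjoint from [p] is independent of it; any other [q] != [p]
   misses an endpoint of [p], which is then averaged out first. *)
Lemma avg_two_pairs h (K : R) (p q : 'I_s * 'I_s) : symmetric h ->
    (forall x, #|[set y | h x y]|%:R <= K) ->
    (p.1 < p.2)%N -> (q.1 < q.2)%N ->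
  avg (fun X => (h (X p.1) (X p.2))%:R * (h (X q.1) (X q.2))%:R) <=
    edge_density h ^+ 2 + (q == p)%:R * edge_density h
    + ((q.1 == p.1) + (q.2 == p.1) + (q.1 == p.2) + (q.2 == p.2))%:R
      * (K / n * edge_density h).
Proof.
case: p q => [i j] [k l] /= symh leK ij kl.
have nij : i != j by rewrite neq_ltn ij.
have nji : j != i by rewrite eq_sym.
have nkl : k != l by rewrite neq_ltn kl.
have d0 := edge_density_ge0 h.
have avg1 i' j' : i' != j' -> avg (fun X => (h (X i') (X j'))%:R : R) = edge_density h.
  move=> ne; rewrite -[RHS]mulr1 -[X in _ * X](@avg_const R 'I_s T T_gt0).
  by rewrite -(@avg_pair h i' j') //; apply: eq_avg => X; rewrite mulr1.
have K0 : 0 <= K.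
  by have /card_gt0P[x _] := T_gt0; apply: le_trans (leK x); rewrite ler0n.
have Kd0 : 0 <= K / n * edge_density h by rewrite mulr_ge0 // divr_ge0 ?ler0n.
have [[-> ->]|npq] := eqVneq (k, l) (i, j).
  apply: le_trans (_ : edge_density h <= _); last first.
    by rewrite mul1r addrAC lerDr addr_ge0 ?exprn_ge0 // mulr_ge0 ?ler0n.
  rewrite -(avg1 i j nij) le_avg // => X.
  by case: (h _ _); rewrite ?mulr1 ?mulr0.
have upd_out (i' j' k' l' : 'I_s) : k' != j' -> l' != j' -> forall X a,
    (h (upd X j' a k') (upd X j' a l'))%:R = (h (X k') (X l'))%:R :> R.
  by move=> /negPf nk /negPf nl X a; rewrite !updE nk nl.
have missed i' j' : i' != j' -> k != j' -> l != j' ->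
    avg (fun X => (h (X i') (X j'))%:R * (h (X k) (X l))%:R) <= K / n * edge_density h.
  move=> ne nk nl; rewrite -(avg1 k l nkl); apply: avg_pair_le => //.
  exact: upd_out.
rewrite mul0r addr0.
have [/andP[nkj nlj]|kl_j] := boolP ((k != j) && (l != j)).
  have [/andP[nki nli]|kl_i] := boolP ((k != i) && (l != i)).
    rewrite (@avg_pair h i j); try exact: upd_out; rewrite // avg1 //.
    by rewrite (negPf nkj) (negPf nlj) (negPf nki) (negPf nli) mul0r addr0 expr2.
  apply: le_trans (missed i j nij nkj nlj) _.
  rewrite -[leLHS]add0r lerD ?exprn_ge0 // ler_peMl // ler1n.
  by move: kl_i; rewrite negb_and !negbK; case: eqP; case: eqP; case: eqP; case: eqP.
(* [q] contains [j]. If it also contained [i], the increasing order inside both pairs would force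
   [q = p]. *)
have [nki nli] : k != i /\ l != i.
  move: kl_j npq; rewrite negb_and !negbK xpair_eqE.
  case/orP => /eqP e; rewrite ?e ?eqxx ?andbT ?nji; subst => //= _.
    split=> //; apply/eqP => e; subst; move: ij kl; lia.
apply: le_trans (_ : K / n * edge_density h <= _).
  rewrite -(avg1 k l nkl).
  under eq_avg => X do rewrite symh.
  by rewrite avg1 //; apply: missed.
rewrite -[leLHS]add0r lerD ?exprn_ge0 // ler_peMl // ler1n.
by move: kl_j; rewrite negb_and !negbK; case: eqP; case: eqP; case: eqP; case: eqP.
Qed.

(** Expand the square over [p] and [q] and sum the bounds of [avg_two_pairs]: the independent terms
    cancel the squared mean, the diagonal gives the mean, and the overlaps give the term with
    [4 * s]. *)
Lemma variance_hit_pairs h (K : R) : symmetric h ->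
    (forall x, #|[set y | h x y]|%:R <= K) ->
  avg (fun X => (#|hit_pairs h X|%:R - N%:R * edge_density h) ^+ 2) <=
    N%:R * edge_density h * (1 + (4 * s)%:R * (K / n)).
Proof.
move=> symh leK; set mu := edge_density h.
have -> : avg (fun X => (#|hit_pairs h X|%:R - N%:R * mu) ^+ 2) =
    avg (fun X => #|hit_pairs h X|%:R ^+ 2) - (N%:R * mu) ^+ 2.
  transitivity (avg (fun X => #|hit_pairs h X|%:R ^+ 2 +
      (- 2 * (N%:R * mu) * #|hit_pairs h X|%:R + (N%:R * mu) ^+ 2))).
    by apply: eq_avg => X; ring.
  by rewrite avgD avgD avgZ avg_hit_pairs avg_const // -/mu; ring.
rewrite lerBlDr.
under eq_avg => X.
  rewrite card_hit_pairs expr2 mulr_suml; under eq_bigr => p _ do rewrite mulr_sumr.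
  over.
rewrite avg_sum; under eq_bigr => p _ do rewrite avg_sum.
apply: le_trans (_ : \sum_(p | P p) (mu * (1 + (4 * s)%:R * (K / n)) + N%:R * mu ^+ 2) <= _);
  last first.
  by rewrite sumr_const -cardsE -/N -[leLHS]mulr_natr le_eqVlt; apply/orP; left; apply/eqP; ring.
apply: ler_sum => p pp.
apply: le_trans (ler_sum _ (fun q qq => avg_two_pairs symh leK pp qq)) _.
have d0 : 0 <= mu := edge_density_ge0 h.
have K0 : 0 <= K.
  by have /card_gt0P[x _] := T_gt0; apply: le_trans (leK x); rewrite ler0n.
have Kd0 : 0 <= K / n * mu by rewrite mulr_ge0 // divr_ge0 ?ler0n.
rewrite !big_split /= -/mu.
have -> : \sum_(q | P q) mu ^+ 2 = N%:R * mu ^+ 2.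
  by rewrite sumr_const -cardsE mulr_natl.
rewrite -!mulr_suml.
have -> : \sum_(q | P q) (q == p)%:R = 1 :> R.
  by rewrite (bigD1 p) //= eqxx big1 ?addr0 // => q /andP[_ /negPf->].
rewrite mul1r.
(* Each of the four coincidences fixes one coordinate of [q], leaving at most [s] choices for the
   other. *)
suff cle : (\sum_(q | P q) ((q.1 == p.1) + (q.2 == p.1) + (q.1 == p.2) + (q.2 == p.2))
            <= 4 * s)%N.
  have := ler_wpM2r Kd0 (_ : _ <= (4 * s)%:R); rewrite -(ler_nat R) natr_sum in cle.
  by move=> /(_ _ cle); lra.
apply: leq_trans (_ : \sum_(q : 'I_s * 'I_s)
  ((q.1 == p.1) + (q.2 == p.1) + (q.1 == p.2) + (q.2 == p.2)) <= _)%N.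
  by rewrite [leqRHS](bigID P) leq_addr.
have card1 (F : 'I_s -> nat) x : (forall y, F y = (y == x)) -> (\sum_y F y = 1)%N.
  by move=> eF; rewrite (bigD1 x) //= eF eqxx big1 // => y /negPf ne; rewrite eF ne.
have fst_eq x : (\sum_(q : 'I_s * 'I_s) (q.1 == x) = s)%N.
  rewrite -(pair_bigA _ (fun a b => (a == x) : nat)) exchange_big /=.
  by rewrite (eq_bigr (fun=> 1%N)) ?sum1_card ?card_ord // => y _; apply: (card1 _ x).
have snd_eq x : (\sum_(q : 'I_s * 'I_s) (q.2 == x) = s)%N.
  rewrite -(pair_bigA _ (fun a b => (b == x) : nat)) /=.
  by rewrite (eq_bigr (fun=> 1%N)) ?sum1_card ?card_ord // => y _; apply: (card1 _ x).
by rewrite !big_split /= !fst_eq !snd_eq; lia.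
Qed.

End PairCount.

(** Swapping coordinates exchanges the increasing and the decreasing pairs, and irreflexivity
    excludes the diagonal. *)
Lemma card_sym_pairs n (h : rel 'I_n) : symmetric h -> irreflexive h ->
  (#|[set p : 'I_n * 'I_n | h p.1 p.2]| =
   2 * #|[set p : 'I_n * 'I_n | (p.1 < p.2) && h p.1 p.2]|)%N.
Proof.
move=> symh irrh; pose sw (p : 'I_n * 'I_n) := (p.2, p.1).
have swK : involutive sw by case.
set A := [set p | h p.1 p.2]; set B := [set p : 'I_n * 'I_n | _].
have mem_sw p : (p \in sw @: B) = (sw p \in B).
  by rewrite -{1}[p]swK mem_imset //; apply: can_inj swK.
have -> : A = B :|: sw @: B.
  apply/setP => -[i j]; rewrite 2!inE mem_sw !inE /= [h j i]symh -andb_orl.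
  by case: (ltngtP i j) => //= /val_inj->; rewrite irrh.
have BI : B :&: sw @: B = set0.
  apply/setP => -[i j]; rewrite inE mem_sw !inE /=.
  by case: ltngtP; rewrite ?andbF.
by rewrite cardsU BI cards0 subn0 (card_imset _ (can_inj swK)) mul2n addnn.
Qed.

Lemma card_slot_pairs s :
  (2 * #|[set p : 'I_s * 'I_s | (p.1 < p.2)%N]| = s * (s - 1))%N.
Proof.
have -> : [set p : 'I_s * 'I_s | (p.1 < p.2)%N] =
    [set p : 'I_s * 'I_s | (p.1 < p.2)%N && (p.1 != p.2)].
  by apply/setP => p; rewrite !inE neq_ltn; case: ltngtP.
rewrite -(card_sym_pairs (h := fun i j => i != j)); last by move=> i; rewrite eqxx.
  have := cardsC [set p : 'I_s * 'I_s | p.1 == p.2].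
  have -> : [set p : 'I_s * 'I_s | p.1 == p.2] = (fun i => (i, i)) @: setT.
    apply/setP => -[i j]; rewrite inE /=; apply/eqP/imsetP => [->|[k _ [-> ->]] //].
    by exists j.
  rewrite card_imset => [|i j [] //].
  rewrite cardsT card_prod !card_ord mulnBr muln1 => <-.
  rewrite addKn; apply: eq_card => -[i j]; rewrite !inE /=; congr negb.
  apply/eqP/imsetP => [->|[k _ [-> ->]] //].
  by exists j.
by move=> i j; rewrite eq_sym.
Qed.

(** * The law of the reservoir *)

Section ReservoirLaw.
Variables (s m : nat).
Implicit Types (fl : flips s m) (i : 'I_s).

(** The 0-based stream position of the edge held by the slot. The default 0 agrees with the dummy
    initial state of [res]. *)
Fixpoint last_flip fl (t : nat) i : nat :=
  if t is t'.+1 then if flip_at fl t' i then t' else last_flip fl t' i else 0.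

Lemma last_flip_le fl t i : (last_flip fl t.+1 i <= t)%N.
Proof.
by elim: t => [|t IH] /=; case: ifP => // _; apply: leqW.
Qed.

Lemma last_flip_lt fl t i : (0 < t)%N -> (last_flip fl t i < t)%N.
Proof. by case: t => // t _; rewrite ltnS last_flip_le. Qed.

Lemma last_flipP fl t i x : (0 < t)%N ->
  last_flip fl t i = x <->
  [/\ (x < t)%N, flip_at fl x i || (x == 0%N) &
      forall u, (x < u < t)%N -> ~~ flip_at fl u i].
Proof.
case: t => // t _; elim: t x => [|t IH] x.
  rewrite /=; split=> [<-|[]]; last by rewrite if_same; case: x.
  by rewrite if_same orbT; split=> // u; rewrite ltnS; lia.
rewrite [last_flip _ _ _]/=; case: ifP => flt.
  split=> [<-|[xt _ noflip]]; first by rewrite flt; split=> // u; lia.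
  case: (ltngtP x t.+1) => [lt_xt|gt_xt|->//]; last by lia.
  by have := noflip t.+1; rewrite lt_xt ltnSn flt => /(_ isT).
rewrite IH; split=> -[xt fx noflip]; split=> //.
- exact: leqW.
- move=> u /andP[xu]; rewrite ltnS leq_eqVlt => /orP[/eqP->|ut]; first by rewrite flt.
  by apply: noflip; rewrite xu.
- move: xt; rewrite ltnS leq_eqVlt => /orP[/eqP ext|//].
  by move: fx; rewrite ext flt.
- by move=> u /andP[xu ut]; apply: noflip; rewrite xu leqW.
Qed.

Lemma flip_at_ord fl (u : 'I_m) i : flip_at fl u i = fl (u, i).
Proof.
apply/existsP/idP => [[x /andP[/eqP/val_inj->]] //|fu].
by exists u; rewrite eqxx.
Qed.

Lemma res_last_flip (V : finType) (es : seq {set V}) fl t i :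
  res es fl t i = nth set0 es (last_flip fl t i).
Proof. by elim: t => //= t ->; case: ifP. Qed.

Hypothesis m_gt0 : (0 < m)%N.

Definition final_index fl : {ffun 'I_s -> 'I_m} :=
  [ffun i => Ordinal (last_flip_lt fl i m_gt0)].

(* The outcomes of flip [u] compatible with [last_flip] being [x]; the value 0 does
   not need a flip at 0, as the dummy initial state already holds the first edge. *)
Let ok (x u : 'I_m) (b : bool) :=
  ((u == x) ==> b || (val x == 0%N)) && ((x < u)%N ==> ~~ b).

Lemma final_indexE fl (X : {ffun 'I_s -> 'I_m}) :
  (final_index fl == X) = [forall i, [forall u, ok (X i) u (fl (u, i))]].
Proof.
apply/eqP/forallP => [<- i|okX].
  have [_ fx noflip] := (last_flipP fl i (last_flip fl m i) m_gt0).1 erefl.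
  apply/forallP => u; rewrite /ok ffunE /= -flip_at_ord; apply/andP; split.
    by apply/implyP => /eqP eu; move: fx; rewrite [val u](congr1 val eu).
  by apply/implyP => xu; apply: noflip; rewrite xu ltn_ord.
apply/ffunP => i; apply: val_inj; rewrite ffunE /=.
have /forallP okXi := okX i; apply/(last_flipP fl i _ m_gt0); split=> //.
  by have /andP[+ _] := okXi (X i); rewrite eqxx -flip_at_ord.
move=> u /andP[xu um]; have /andP[_] := okXi (Ordinal um).
by rewrite -flip_at_ord /= xu.
Qed.

Variable R : rcfType.

Let w (t : 'I_m) (b : bool) : R := if b then t.+1%:R^-1 else 1 - t.+1%:R^-1.

(* The product telescopes: 1/(x+1) * (x+1)/(x+2) * ... * (m-1)/m = 1/m. *)
Lemma prod_ok_weights (x : 'I_m) : \prod_(u < m) \sum_(b | ok x u b) w u b = m%:R^-1.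
Proof.
pose c (u : nat) : R := if (u < x)%N then 1 else if u == x then x.+1%:R^-1 else u%:R / u.+1%:R.
have -> : \prod_(u < m) \sum_(b | ok x u b) w u b = \prod_(u < m) c u.
  apply: eq_bigr => u _; rewrite big_mkcond big_bool /= /ok /c /w /= !implybT.
  rewrite -(inj_eq val_inj) /=.
  have u1 : u.+1%:R != 0 :> R by rewrite pnatr_eq0.
  case: ltngtP => [ux|xu|->] /=.
  - by rewrite add0r -natr1; field; rewrite natr1.
  - by rewrite addrC subrK.
  (* At position 0 both outcomes are allowed, with weights 1 and 0, so the sum is still the inverse
     of [x.+1]. *)
  - by rewrite andbT; case: eqP => [->|_]; rewrite ?invr1 ?subrr addr0.
have -> : forall k, \prod_(u < k) c u = if (x < k)%N then k%:R^-1 else 1.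
  elim=> [|k IH]; first by rewrite big_ord0.
  rewrite big_ord_recr /= IH /c ltnS; case: ltngtP => [xk|kx|->].
  - have k0 : k%:R != 0 :> R by rewrite pnatr_eq0; lia.
    by rewrite mulKf.
  - by rewrite mulr1.
  - by rewrite mul1r.
by rewrite ltn_ord.
Qed.

(** By [final_indexE] the event of ending at [X] constrains each flip separately, so its weight is a
    product over slots, each contributing 1/m. Hence the final positions are independent and
    uniform. *)
Lemma sum_weight_final_index (F : {ffun 'I_s -> 'I_m} -> R) :
  \sum_(fl : flips s m) weight R fl * F (final_index fl) = avg F.
Proof.
(* Currying the flips by slot prepares the exchange of the sum with both products. *)
pose h (g : {ffun 'I_s -> {ffun 'I_m -> bool}}) : flips s m := [ffun ui => g ui.2 ui.1].
have hbij : bijective h.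
  exists (fun fl => [ffun i => [ffun u => fl (u, i)]]).
    by move=> g; apply/ffunP => i; apply/ffunP => u; rewrite !ffunE.
  by move=> fl; apply/ffunP => -[u i]; rewrite !ffunE.
rewrite (partition_big (@final_index) predT) //= /avg mulr_suml.
apply: eq_bigr => X _.
under eq_bigr => fl /eqP -> do over.
rewrite -mulr_suml mulrC; congr (_ * _).
rewrite (reindex h) /=; last exact: onW_bij.
transitivity (\sum_(g in family (fun i => family (fun u => ok (X i) u)))
    \prod_i \prod_u w u (g i u)).
  apply: eq_big => [g|g _].
    rewrite final_indexE; apply/forallP/familyP => H i.
      by apply/familyP => u; have /forallP/(_ u) := H i; rewrite ffunE.
    apply/forallP => u; have /familyP/(_ u) := H i; by rewrite ffunE.
  rewrite /weight exchange_big; apply: eq_bigr => i _; apply: eq_bigr => u _.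
  by rewrite ffunE.
rewrite -(bigA_distr_big_dep _ (fun i (f : {ffun 'I_m -> bool}) => \prod_u w u (f u))) /=.
under eq_bigr => i _ do rewrite -(bigA_distr_big_dep _ w) prod_ok_weights.
by rewrite prodr_const card_ffun !card_ord natrX exprVn.
Qed.

End ReservoirLaw.

(** * Wedges and future-closed wedges *)

Section PairsOfEdges.
Variable V : finType.
Implicit Types (A B S g : {set V}).
Local Open Scope nat_scope.

Lemma is_wedge_sym : symmetric (@is_wedge V).
Proof. by move=> A B; rewrite /is_wedge eq_sym setIC. Qed.

Lemma closes_sym g A B : closes g A B = closes g B A.
Proof. by rewrite /closes setUC setIC. Qed.

Lemma card_setI_edges A B : #|A| = 2 -> #|B| = 2 -> A != B -> #|A :&: B| < 2.
Proof.
move=> cA cB; apply: contraNltn => cI; rewrite eqEcard cA cB leqnn andbT.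
apply/setIidPl/eqP; rewrite eqEcard subsetIl cA; exact: cI.
Qed.

Lemma is_wedge_common v A B :
  #|A| = 2 -> #|B| = 2 -> A != B -> v \in A -> v \in B -> is_wedge A B.
Proof.
move=> cA cB ne vA vB; rewrite /is_wedge ne eqn_leq -ltnS card_setI_edges //=.
by apply/card_gt0P; exists v; rewrite inE vA.
Qed.

Lemma card_wedgeU A B : #|A| = 2 -> #|B| = 2 -> is_wedge A B -> #|A :|: B| = 3.
Proof. by move=> cA cB /andP[_ /eqP cI]; rewrite cardsU cA cB cI. Qed.

(** The closing edge avoids the shared vertex, which lies in [A]. *)
Lemma closes_neql g A B : is_wedge A B -> closes g A B -> g != A.
Proof.
case/andP=> _ /eqP cI /eqP->; apply/eqP => e.
have /card_gt0P[v vI] : 0 < #|A :&: B| by rewrite cI.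
have : v \in A by case/setIP: vI.
by rewrite -e inE vI.
Qed.

Lemma closes_neqr g A B : is_wedge A B -> closes g A B -> g != B.
Proof. by rewrite is_wedge_sym closes_sym; apply: closes_neql. Qed.

Lemma card_closes g A B :
  #|A| = 2 -> #|B| = 2 -> is_wedge A B -> closes g A B -> #|g| = 2.
Proof.
move=> cA cB wAB /eqP->; rewrite cardsD card_wedgeU //.
have /andP[_ /eqP cI] := wAB.
rewrite (_ : (A :|: B) :&: (A :&: B) = A :&: B) ?cI //.
by apply/setIidPr/subsetP => v /setIP[vA _]; rewrite inE vA.
Qed.

Definition edges_of S : {set {set V}} := [set f : {set V} | (f \subset S) && (#|f| == 2)].

Lemma card_edges_of S : #|S| = 3 -> #|edges_of S| = 3.
Proof. by move=> cS; rewrite cards_draws cS. Qed.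

(** The three edges are distinct, and a 3-set has only three 2-subsets. *)
Lemma edges_of_closed_wedge g A B : #|A| = 2 -> #|B| = 2 -> is_wedge A B ->
  closes g A B -> edges_of (A :|: B) = [set A; B; g].
Proof.
move=> cA cB wAB cl; apply/esym/eqP; rewrite eqEcard card_edges_of ?card_wedgeU //.
have ne : A != B by case/andP: wAB.
apply/andP; split; last first.
  rewrite setUC cardsU1 !inE negb_or (closes_neql wAB cl) (closes_neqr wAB cl).
  by rewrite cards2 ne.
apply/subsetP => f; rewrite !inE => /orP[/orP[]|] /eqP->.
- by rewrite subsetUl cA.
- by rewrite subsetUr cB.
- by rewrite (card_closes cA cB wAB cl) (eqP cl) subsetDl.
Qed.

End PairsOfEdges.

(** * Wedges and triangles as relations on stream positions *)

Section Stream.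
Variables (V : finType) (es : seq {set V}).
Hypothesis es_uniq : uniq es.
Hypothesis es_edges : all (fun e : {set V} => #|e| == 2%N) es.
Local Open Scope nat_scope.

Let m := size es.
Let edge (x : nat) : {set V} := nth set0 es x.

Definition wedge_rel : rel 'I_m := fun x y => is_wedge (edge x) (edge y).

(** The comparisons with [u] are not strict because [Cset] tests closure after the slots have been
    updated. A closing edge differs from both wedge edges, so [u] is in fact later than both. *)
Definition future_closed : rel 'I_m := fun x y =>
  wedge_rel x y &&
  [exists u : 'I_m, [&& x <= u, y <= u & closes (edge u) (edge x) (edge y)]].

Let edge_inj x y : x < m -> y < m -> edge x = edge y -> x = y.
Proof. by move=> xm ym /eqP; rewrite nth_uniq // => /eqP. Qed.

Let card_edge x : x < m -> #|edge x| = 2.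
Proof. by move=> xm; apply/eqP/(allP es_edges)/mem_nth. Qed.

Let edge_neq (x y : 'I_m) : x < y -> edge x != edge y.
Proof. by rewrite ltn_neqAle => /andP[ne _]; rewrite nth_uniq ?ltn_ord. Qed.

Let edge_mem (x : 'I_m) : edge x \in es.
Proof. exact/mem_nth/ltn_ord. Qed.

Let edge_ex (f : {set V}) : f \in es -> exists x : 'I_m, f = edge x.
Proof.
move=> fes; have ix : index f es < m by rewrite index_mem.
by exists (Ordinal ix); rewrite /edge /= nth_index.
Qed.

Lemma wedge_rel_sym : symmetric wedge_rel.
Proof. by move=> x y; apply: is_wedge_sym. Qed.

Lemma wedge_rel_irr : irreflexive wedge_rel.
Proof. by move=> x; rewrite /wedge_rel /is_wedge eqxx. Qed.

Lemma future_closed_sym : symmetric future_closed.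
Proof.
move=> x y; rewrite /future_closed wedge_rel_sym; congr (_ && _).
by apply: eq_existsb => u; rewrite closes_sym andbCA.
Qed.

Lemma future_closed_irr : irreflexive future_closed.
Proof. by move=> x; rewrite /future_closed wedge_rel_irr. Qed.

Lemma nwedges_wedge_rel :
  nwedges es = #|[set p : 'I_m * 'I_m | (p.1 < p.2) && wedge_rel p.1 p.2]|.
Proof.
rewrite /nwedges; set D := [set p : 'I_m * 'I_m | _].
pose f (p : 'I_m * 'I_m) := [set edge p.1; edge p.2].
have f_inj : {in D &, injective f}.
  move=> [x y] [x' y']; rewrite !inE /= => /andP[xy _] /andP[xy' _] /setP eqf.
  have mem a b c : edge a \in [set edge b; edge c] -> a < m -> b < m -> c < m -> a = b \/ a = c.
    by rewrite !inE => /orP[] /eqP e am bm cm; [left|right]; apply: edge_inj.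
  have := eqf (edge x); rewrite {1}/f !inE eqxx /= => /esym; rewrite -in_set2.
  move=> /mem/(_ (ltn_ord _) (ltn_ord _) (ltn_ord _)) hx.
  have := eqf (edge y); rewrite {1}/f !inE eqxx orbT /= => /esym; rewrite -in_set2.
  move=> /mem/(_ (ltn_ord _) (ltn_ord _) (ltn_ord _)) hy.
  by congr (_, _); apply: val_inj => /=; lia.
rewrite -(card_in_imset f_inj); apply: eq_card => P; rewrite inE.
apply/existsP/imsetP => [[a /existsP[b /and4P[/edge_ex[x ->] /edge_ex[y ->] w /eqP->]]]|].
  case: (ltngtP x y) => [xy|yx|/val_inj exy].
  - by exists (x, y) => //; rewrite inE /= xy.
  - by exists (y, x); [rewrite inE /= yx wedge_rel_sym | rewrite /f setUC].
  - by move: w; rewrite exy /is_wedge eqxx.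
case=> -[x y]; rewrite inE /= => /andP[_ w ->].
by exists (edge x); apply/existsP; exists (edge y); rewrite !edge_mem (w : is_wedge _ _) /f /= eqxx.
Qed.

(** A triangle corresponds to the positions of its two earliest edges, the third edge being the one
    that closes them. The map [f] recovers the vertex set. *)
Lemma ntri_future_closed :
  ntri es = #|[set p : 'I_m * 'I_m | (p.1 < p.2) && future_closed p.1 p.2]|.
Proof.
rewrite /ntri; set D := [set p : 'I_m * 'I_m | _].
pose f (p : 'I_m * 'I_m) := edge p.1 :|: edge p.2.
have inD x y : (x, y) \in D -> exists u : 'I_m, [/\ x < y, y < u &
    edges_of (edge x :|: edge y) = [set edge x; edge y; edge u]].
  rewrite inE /= => /and3P[xy w /existsP[u /and3P[_ yu cl]]]; exists u.
  split=> //; last by apply: edges_of_closed_wedge; rewrite ?card_edge.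
  rewrite ltn_neqAle yu andbT; apply/eqP => /val_inj eyu.
  by have := closes_neqr w cl; rewrite eyu eqxx.
have f_inj : {in D &, injective f}.
  move=> [x y] [x' y'] /inD[u [xy yu E]] /inD[u' [xy' yu' E']]; rewrite /f /= => eqf.
  (* Equal vertex sets give the same three positions, and two increasing listings of them must
     agree. *)
  have mem (a : 'I_m) : edge a \in [set edge x; edge y; edge u] ->
      a = x' :> nat \/ a = y' :> nat \/ a = u' :> nat.
    rewrite -E eqf E' !inE => /orP[/orP[]|] /eqP /edge_inj h.
    - by left; apply: h.
    - by right; left; apply: h.
    - by right; right; apply: h.
  have := mem x; rewrite !inE eqxx => /(_ isT) hx.
  have := mem y; rewrite !inE eqxx orbT => /(_ isT) hy.
  have := mem u; rewrite !inE eqxx orbT => /(_ isT) hu.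
  by congr (_, _); apply: val_inj => /=; lia.
rewrite -(card_in_imset f_inj); apply: eq_card => S; rewrite inE.
apply/andP/imsetP => [[/eqP cS /forallP triS]|[[x y] pD ->]]; last first.
  have [u [xy yu E]] := inD _ _ pD; split.
    move: pD; rewrite inE => /and3P[_ w _]; apply/eqP/card_wedgeU => //; exact: card_edge.
  apply/forallP => g; apply/implyP => gS; have : g \in edges_of (f (x, y)) by rewrite inE.
  by rewrite E !inE => /orP[/orP[]|] /eqP->; apply: edge_mem.
(* Surjectivity: the positions of the three edges of [S] are listed in increasing order. *)
pose I := [set x : 'I_m | edge x \in edges_of S].
have cI : #|I| = 3.
  rewrite -(card_edges_of cS) -(card_in_imset (f := fun x : 'I_m => edge x) (D := I)).
    apply: eq_card => g; apply/imsetP/idP => [[x xI ->]|gS]; first by rewrite inE in xI.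
    have := triS g; rewrite inE in gS; rewrite gS => /edge_ex[x ex].
    by exists x => //; rewrite !inE -ex.
  by move=> x y _ _ /edge_inj e; apply/val_inj/e.
have [x [y [u [xy yu eI]]]] : exists x y u : 'I_m, [/\ x < y, y < u & enum I = [:: x; y; u]].
  have : sorted ltn (map val (enum I)).
    rewrite sorted_map; apply: sorted_filter; first by move=> ? ? ?; apply: ltn_trans.
    rewrite -sorted_map -enumT val_enum_ord; exact: iota_ltn_sorted.
  move: cI; rewrite cardE; case: (enum I) => [|x [|y [|u []]]] //= _ /and3P[xy yu _].
  by exists x, y, u.
have memI z : z \in [:: x; y; u] -> edge z \subset S /\ #|edge z| = 2.
  by rewrite -eI mem_enum !inE => /andP[zS /eqP].
have [xS cx] : edge x \subset S /\ #|edge x| = 2 by apply: memI; rewrite !inE eqxx.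
have [yS cy] : edge y \subset S /\ #|edge y| = 2 by apply: memI; rewrite !inE eqxx orbT.
have [uS cu] : edge u \subset S /\ #|edge u| = 2 by apply: memI; rewrite !inE eqxx !orbT.
have nxy : edge x != edge y := edge_neq xy.
have xyS : edge x :|: edge y \subset S by rewrite subUset xS.
have w : wedge_rel x y.
  rewrite /wedge_rel /is_wedge nxy /=.
  have := card_setI_edges cx cy nxy; have := cardsUI (edge x) (edge y).
  have := subset_leq_card xyS; lia.
have eS : edge x :|: edge y = S.
  by apply/eqP; rewrite eqEcard xyS cS card_wedgeU.
(* Taking the symmetric difference itself as closing edge, [edge u] is one of the three edges inside
   [S] and differs from the first two, so it closes the wedge. *)
have := @edges_of_closed_wedge _ _ _ _ cx cy w (eqxx _).
rewrite eS => /setP/(_ (edge u)); rewrite !inE uS cu eqxx /=.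
rewrite ![edge u == _]eq_sym (negPf (edge_neq yu)) (negPf (edge_neq (ltn_trans xy yu))).
move=> /esym /= cl; exists (x, y) => //; rewrite inE /= xy /future_closed w /=.
by apply/existsP; exists u; rewrite (ltnW yu) (ltnW (ltn_trans xy yu)) /closes eS eq_sym cl.
Qed.

Lemma future_closed_wedge x y : future_closed x y -> wedge_rel x y.
Proof. by case/andP. Qed.

Let wedges := [set p : 'I_m * 'I_m | wedge_rel p.1 p.2].

(** The square of [C] is covered by its diagonal and the ordered wedge pairs. *)
Lemma clique_card_le (C : {set 'I_m}) : {in C &, forall x y, x != y -> wedge_rel x y} ->
  #|C| ^ 2 <= #|C| + #|wedges|.
Proof.
move=> clq; rewrite -mulnn -cardsX; have <- : #|[set (x, x) | x in C]| = #|C|.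
  by rewrite card_imset // => x y [].
apply: leq_trans (leq_card_setU _ _); apply/subset_leq_card/subsetP => -[x y].
rewrite !inE /= => /andP[xC yC]; have [<-|ne] := eqVneq x y.
  by apply/orP; left; apply/imsetP; exists x.
by rewrite clq ?orbT.
Qed.

(* The edges at an endpoint of [x] form a clique, so [x] has at most
   [sqrt #|wedges|] neighbours through each of its two endpoints. *)
Lemma wedge_degree_le (x : 'I_m) : #|[set y | wedge_rel x y]| ^ 2 <= 4 * #|wedges|.
Proof.
have /eqP/cards2P[a [b [nab exE]]] := card_edge (ltn_ord x).
pose star v := [set y : 'I_m | v \in edge y].
(* If the star has k edges besides [x], the clique bound reads (k+1)^2 <= k+1 + [#|wedges|], whence
   k^2 <= [#|wedges|]. *)
have star_le v : v \in edge x -> #|star v :\ x| ^ 2 <= #|wedges|.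
  move=> vx; have xS : x \in star v by rewrite inE.
  have := @clique_card_le (star v); rewrite (cardsD1 x (star v)) xS.
  have clq : {in star v &, forall y z, y != z -> wedge_rel y z}.
    move=> y z; rewrite !inE => vy vz ne.
    apply: (is_wedge_common _ _ _ vy vz); rewrite ?card_edge //.
    by rewrite nth_uniq ?ltn_ord.
  by move=> /(_ clq); rewrite add1n -!mulnn; nia.
have le_deg : #|[set y | wedge_rel x y]| <= #|star a :\ x| + #|star b :\ x|.
  apply: leq_trans (leq_card_setU _ _); apply/subset_leq_card/subsetP => y.
  rewrite !inE => w; have -> : y != x by apply: contraTneq w => ->; rewrite wedge_rel_irr.
  have /andP[_ /eqP cI] := w; have /card_gt0P[v] : 0 < #|edge x :&: edge y| by rewrite cI.
  by rewrite inE exE !inE => /andP[/orP[]/eqP-> ->]; rewrite ?orbT.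
have ha := star_le a; rewrite exE !inE eqxx in ha; have {}ha := ha isT.
have hb := star_le b; rewrite exE !inE eqxx orbT in hb; have {}hb := hb isT.
have sqr_add_le d p q w : d <= p + q -> p ^ 2 <= w -> q ^ 2 <= w -> d ^ 2 <= 4 * w.
  by move=> dpq pw qw; have := nat_Cauchy p q; have := leq_mul dpq dpq; nia.
exact: sqr_add_le le_deg ha hb.
Qed.

(** * The sets W_m and C_m in terms of final positions *)

Section Detection.
Variable s : nat.
Hypothesis m_gt0 : 0 < m.
Implicit Types fl : flips s m.

Let final := @final_index s m m_gt0.

Lemma Wset_final fl : Wset es fl m = hit_pairs wedge_rel (final fl).
Proof. by apply/setP => p; rewrite !inE !res_last_flip /final !ffunE. Qed.

Let last_lt fl t i : t <= m -> last_flip fl t i < m.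
Proof.
by case: t => // t; apply: leq_trans; rewrite ltnS; apply: last_flip_le.
Qed.

(** A detected element persists while both slots keep their edges, so what matters is a closing step
    [u] no earlier than the insertion of either current edge. *)
Lemma Cset_last_flip fl t (p : 'I_s * 'I_s) : t <= m ->
  p \in Cset es fl t <->
  p \in Wset es fl t /\
  exists u, [/\ u < t, last_flip fl t p.1 <= u, last_flip fl t p.2 <= u &
    closes (edge u) (res es fl t p.1) (res es fl t p.2)].
Proof.
elim: t => [|t IH] tm; first by rewrite inE; split=> // -[_ [u []]].
have -> : (p \in Cset es fl t.+1) = (p \in Wset es fl t.+1) &&
    ([&& p \in Cset es fl t, res es fl t p.1 == res es fl t.+1 p.1
       & res es fl t p.2 == res es fl t.+1 p.2]
     || closes (edge t) (res es fl t.+1 p.1) (res es fl t.+1 p.2)).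
  by rewrite [in LHS]inE.
split.
  case/andP=> pW /orP[/and3P[pC /eqP e1 /eqP e2]|cl]; split=> //.
    have [_ [u [ut u1 u2 cl]]] := (IH (ltnW tm)).1 pC; exists u; rewrite -e1 -e2.
    (* Stream edges are distinct, so an unchanged edge means an unchanged position. *)
    have eqL i : res es fl t i = res es fl t.+1 i -> last_flip fl t.+1 i = last_flip fl t i.
      by rewrite !res_last_flip => /edge_inj h; apply/esym/h; apply: last_lt => //; apply: ltnW.
    by rewrite !eqL //; split=> //; apply: leqW.
  by exists t; split=> //; apply: last_flip_le.
case=> pW [u [ut u1 u2 cl]]; rewrite pW /=.
move: ut; rewrite ltnS leq_eqVlt => /orP[/eqP eu|ut].
  by move: cl; rewrite eu => ->; rewrite orbT.
(* A slot whose edge was inserted by step [u < t] is not overwritten at step [t]. *)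
have nofl i : last_flip fl t.+1 i <= u -> flip_at fl t i = false.
  by move=> /=; case: ifP => // _; lia.
move: u1 u2 (nofl _ u1) (nofl _ u2) pW cl => /= u1 u2 n1 n2.
rewrite inE /= !n1 !n2 !eqxx !andbT => pW cl; apply/orP; left.
rewrite n1 in u1; rewrite n2 in u2.
by apply/(IH (ltnW tm)); split; [rewrite inE | exists u].
Qed.

Lemma Cset_final fl : Cset es fl m = hit_pairs future_closed (final fl).
Proof.
apply/setP => p; apply/idP/idP.
  move/(Cset_last_flip fl p (leqnn m)) => [pW [u [um u1 u2 cl]]].
  move: pW; rewrite Wset_final !inE /future_closed => /andP[-> ->] /=.
  apply/existsP; exists (Ordinal um); rewrite /final !ffunE /= u1 u2.
  by rewrite !res_last_flip in cl.
rewrite inE => /andP[lt_p /andP[w /existsP[u /and3P[u1 u2 cl]]]].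
apply/(Cset_last_flip fl p (leqnn m)); split; first by rewrite Wset_final inE lt_p.
by exists u; move: u1 u2 cl; rewrite /final !ffunE /= !res_last_flip.
Qed.

End Detection.
End Stream.

(** * Accuracy of the estimates *)

(* As [Z <= Y], replacing the random denominator [Y] by its mean [M]
   moves [Z / Y] by at most [|Y - M| / M]. *)
Lemma ratio_error (R : realFieldType) (Y Z M : R) : 0 <= Z -> Z <= Y -> 0 < M ->
  `|Z / Y - Z / M| <= `|Y - M| / M.
Proof.
(* If [Y] vanishes, so does [Z], and both quotients are 0. *)
move=> Z0 ZY M0; have [Y0|Y0] := eqVneq Y 0.
  have -> : Z = 0 by apply/eqP; rewrite eq_le Z0 -Y0 ZY.
  by rewrite !mul0r subrr normr0 divr_ge0 ?normr_ge0 // ltW.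
have Yp : 0 < Y by rewrite lt_def Y0 (le_trans Z0 ZY).
have -> : Z / Y - Z / M = (Z / Y) * ((M - Y) / M) by field; rewrite !gt_eqF.
have -> : `|Z / Y * ((M - Y) / M)| = Z / Y * (`|Y - M| / M).
  rewrite normrM (ger0_norm (divr_ge0 Z0 (ltW Yp))) normrM distrC.
  by rewrite (ger0_norm (_ : 0 <= M^-1)) // invr_ge0 ltW.
rewrite ler_piMl ?divr_ge0 ?normr_ge0 // ?(ltW M0) //.
by rewrite ler_pdivrMr // mul1r.
Qed.

(** [ratio_error] is averaged over the samples; the ratio of densities is the ratio of means, which
    share the factor [N]. *)
Lemma avg_hit_ratio (R : realFieldType) (s : nat) (T : finType) (h g : rel T) :
    (0 < #|T|)%N -> (forall x y, g x y -> h x y) ->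
    let N : R := #|[set p : 'I_s * 'I_s | (p.1 < p.2)%N]|%:R in
    let M := N * edge_density R h in
    0 < M ->
  `|edge_density R g / edge_density R h -
    avg (fun X : {ffun 'I_s -> T} => #|hit_pairs g X|%:R / #|hit_pairs h X|%:R)|
  <= avg (fun X : {ffun 'I_s -> T} => `|#|hit_pairs h X|%:R - M|) / M.
Proof.
move=> T0 gh N M M0.
have N0 : N != 0 by apply: contraTneq M0 => N0; rewrite /M N0 mul0r ltxx.
have d0 : edge_density R h != 0.
  by apply: contraTneq M0 => d0; rewrite /M d0 mulr0 ltxx.
have -> : edge_density R g / edge_density R h = N * edge_density R g / M.
  by rewrite /M; field; rewrite N0 d0.
rewrite -(@avg_hit_pairs R s T T0) mulrC -avgZ distrC -avgB [leRHS]mulrC -avgZ.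
apply: le_trans (norm_avg_le _) (le_avg _) => X.
rewrite ![M^-1 * _]mulrC; apply: ratio_error => //.
rewrite ler_nat; apply/subset_leq_card/subsetP => p; rewrite !inE.
by case/andP=> -> /gh.
Qed.

Section Main.
Variables (R : rcfType) (V : finType) (es : seq {set V}) (s : nat).
Local Notation m := (size es).
Local Notation W := (nwedges es).
Local Notation h := (@wedge_rel V es).
Local Notation g := (@future_closed V es).
Hypothesis es_uniq : uniq es.
Hypothesis es_edges : all (fun e : {set V} => #|e| == 2%N) es.
Hypothesis m_gt0 : (0 < m)%N.

Lemma edge_density_wedge : edge_density R h = 2 * W%:R / m%:R ^+ 2.
Proof.
rewrite /edge_density (card_sym_pairs (@wedge_rel_sym _ es) (@wedge_rel_irr _ es)).
by rewrite -nwedges_wedge_rel // card_ord natrM.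
Qed.

Lemma edge_density_closed : edge_density R g = 2 * (ntri es)%:R / m%:R ^+ 2.
Proof.
rewrite /edge_density (card_sym_pairs (@future_closed_sym _ es) (@future_closed_irr _ es)).
by rewrite -ntri_future_closed // card_ord natrM.
Qed.

(** Given the flips, the output is 1 with probability |C_m| / |W_m|. For empty W_m the convention
    [0^-1 = 0] agrees with the output 0. *)
Lemma expect_bm_avg : @expect_bm V s m R es =
  avg (fun X : {ffun 'I_s -> 'I_m} => #|hit_pairs g X|%:R / #|hit_pairs h X|%:R).
Proof.
rewrite -(sum_weight_final_index m_gt0); apply: eq_bigr => fl _; congr (_ * _).
rewrite (Cset_final es_uniq es_edges m_gt0) (Wset_final m_gt0).
set X := final_index _ _; have sub : hit_pairs g X \subset hit_pairs h X.
  by apply/subsetP => p; rewrite !inE => /andP[-> /andP[]].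
case: eqP => [->|_]; first by rewrite cards0 invr0 mulr0.
rewrite -mulr_sumr mulrC; congr (_ * _).
rewrite -sum1_card natr_sum (big_setID (hit_pairs g X)) /= addrC big1 ?add0r.
  rewrite (setIidPr sub); apply: eq_bigr => p ->; by [].
by move=> p; rewrite inE => /andP[/negPf->].
Qed.

Lemma prob_avg (E : pred {ffun 'I_s -> 'I_m}) :
  @prob s m R (fun fl => E (final_index m_gt0 fl)) = avg (fun X => (E X)%:R).
Proof.
rewrite -(sum_weight_final_index m_gt0) /prob big_mkcond; apply: eq_bigr => fl _.
by case: (E _); rewrite ?mulr1 ?mulr0.
Qed.

Let N : R := #|[set p : 'I_s * 'I_s | (p.1 < p.2)%N]|%:R.
Let M : R := N * edge_density R h.

Lemma variance_card_wedges :
  avg (fun X : {ffun 'I_s -> 'I_m} => (#|hit_pairs h X|%:R - M) ^+ 2)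
  <= M * (1 + 16 * (s%:R * Num.sqrt W%:R / m%:R)).
Proof.
have T0 : (0 < #|'I_m|)%N by rewrite card_ord.
(* A degree [d] satisfies d^2 <= 8W <= 16W. This 4, times the 4 of the overlap count, gives the 16
   of the statement. *)
have deg x : #|[set y | h x y]|%:R <= 4 * Num.sqrt W%:R :> R.
  have := wedge_degree_le es_uniq es_edges x.
  rewrite (card_sym_pairs (@wedge_rel_sym _ es) (@wedge_rel_irr _ es)).
  rewrite -nwedges_wedge_rel // => leW.
  have q0 : 0 <= Num.sqrt (W%:R : R) := sqrtr_ge0 _.
  rewrite -ler_sqr ?nnegrE ?ler0n ?mulr_ge0 // exprMn sqr_sqrtr ?ler0n //.
  by rewrite -natrX -natrX -natrM ler_nat; lia.
apply: le_trans (variance_hit_pairs s T0 (@wedge_rel_sym _ es) deg) _.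
rewrite card_ord -/N -/M natrM le_eqVlt; apply/orP; left; apply/eqP.
by ring.
Qed.

Variable beta : R.
Hypotheses (b0 : 0 < beta) (b1 : beta < 1).
Hypothesis tri1 : (1 <= ntri es)%N.
Hypothesis s_large : 1000 * m%:R / (beta ^+ 3 * Num.sqrt (ntri es)%:R) <= s%:R.

Lemma ntri_le_nwedges : (ntri es <= W)%N.
Proof.
rewrite ntri_future_closed // nwedges_wedge_rel //.
apply/subset_leq_card/subsetP => p; rewrite !inE => /andP[-> w].
exact: future_closed_wedge w.
Qed.

(** In terms of [z] the variance is at most M(1 + 16z), while M >= z^2/2; so it suffices that 17z <=
    beta^3 z^2/8. *)
Lemma variance_small :
  0 < M /\
  avg (fun X : {ffun 'I_s -> 'I_m} => (#|hit_pairs h X|%:R - M) ^+ 2)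
    <= beta ^+ 3 / 4 * M ^+ 2.
Proof.
set q : R := Num.sqrt W%:R; set z := s%:R * q / m%:R.
have mp : 0 < m%:R :> R by rewrite ltr0n.
have b3 : 0 < beta ^+ 3 by rewrite exprn_gt0.
have b31 : beta ^+ 3 < 1 by rewrite exprn_ilt1 // ltW.
have q2 : q ^+ 2 = W%:R by rewrite sqr_sqrtr ?ler0n.
have qt : Num.sqrt (ntri es)%:R <= q by rewrite ler_wsqrtr // ler_nat ntri_le_nwedges.
have tp : 0 < Num.sqrt (ntri es)%:R :> R by rewrite sqrtr_gt0 ltr0n.
have qp : 0 < q := lt_le_trans tp qt.
have sgt0 : 0 < s%:R :> R.
  by apply: lt_le_trans s_large; rewrite divr_gt0 ?mulr_gt0.
(* This is the lower bound on [s], combined with T <= W. *)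
have bz : 1000 <= beta ^+ 3 * z.
  rewrite /z mulrA ler_pdivlMr //.
  move: s_large; rewrite ler_pdivrMr ?mulr_gt0 // => /le_trans; apply.
  rewrite mulrCA; apply: ler_wpM2l; first exact: ltW.
  by apply: ler_wpM2l; rewrite ?ler0n.
(* There are at most m^2 pairs of positions; this gives z <= s, hence s >= 2. *)
have qm : q <= m%:R.
  rewrite -(ler_pXn2r (n := 2)) // ?nnegrE ?(ltW qp) ?ler0n //.
  rewrite q2 -[leRHS]natrX ler_nat nwedges_wedge_rel //.
  by apply: leq_trans (max_card _) _; rewrite card_prod card_ord mulnn.
have zp : 0 < z by rewrite /z divr_gt0 // mulr_gt0 //; apply: sgt0.
have z1 : 1000 <= z by apply: le_trans bz _; rewrite ler_piMl // ltW.
have s2 : 2 <= s%:R :> R.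
  have : z <= s%:R by rewrite /z ler_pdivrMr // ler_wpM2l ?ler0n.
  by lra.
have NE : 2 * N = s%:R * (s%:R - 1).
  rewrite /N -[2 * _]natrM card_slot_pairs natrM natrB //.
  by rewrite -(ler_nat R); lra.
have Mz : z ^+ 2 / 2 <= M.
  have -> : M = z ^+ 2 * ((s%:R - 1) / s%:R).
    rewrite /M edge_density_wedge -q2 /z.
    transitivity (2 * N * q ^+ 2 / m%:R ^+ 2); first by field; rewrite gt_eqF.
    by rewrite NE; field; rewrite !gt_eqF //; lra.
  rewrite ler_wpM2l ?exprn_ge0 ?(ltW zp) // ler_pdivlMr; first by lra.
  by lra.
have Mp : 0 < M by apply: lt_le_trans Mz; rewrite divr_gt0 ?exprn_gt0.
split=> //; apply: le_trans variance_card_wedges _.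
have -> : beta ^+ 3 / 4 * M ^+ 2 = M * (beta ^+ 3 / 4 * M) by ring.
rewrite -/q -/z ler_pM2l //.
(* First 1 <= z is used, then beta^3 z >= 1000 >= 8 * 17. *)
apply: le_trans (_ : 17 * z <= _); first by lra.
apply: le_trans (_ : beta ^+ 3 / 4 * (z ^+ 2 / 2) <= _); last first.
  by rewrite ler_wpM2l // ltW // divr_gt0.
have -> : beta ^+ 3 / 4 * (z ^+ 2 / 2) = (beta ^+ 3 * z) * z / 8 by field.
by rewrite ler_pdivlMr // mulrAC ler_wpM2r ?(ltW zp) //; lra.
Qed.

Lemma single_bit_bounds :
  `| 3 * (ntri es)%:R / W%:R / 3 - @expect_bm V s m R es | < beta /\
  1 - beta < @prob s m R (fun fl => `| W%:R - @est V s m R es fl | < beta * W%:R).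
Proof.
have T0 : (0 < #|'I_m|)%N by rewrite card_ord.
have [Mp varM] := variance_small.
have W0 : W%:R != 0 :> R.
  by rewrite pnatr_eq0 -lt0n; apply: leq_trans tri1 ntri_le_nwedges.
have m0 : m%:R != 0 :> R by rewrite pnatr_eq0 -lt0n.
have bM : 0 < beta * M by rewrite mulr_gt0.
split.
  have -> : 3 * (ntri es)%:R / W%:R / 3 = edge_density R g / edge_density R h.
    by rewrite edge_density_wedge edge_density_closed; field; rewrite W0 m0.
  rewrite expect_bm_avg; apply: le_lt_trans (avg_hit_ratio T0 (@future_closed_wedge _ es) Mp) _.
  (* With [b = beta * M] it remains to see that the variance is below (beta M)^2; it is at most
     beta/4 times that. *)
  rewrite -/N -/M ltr_pdivrMr //; apply: le_lt_trans (avg_norm_le T0 _ bM) _.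
  rewrite ltr_pdivrMr // mulr_natr mulr2n ltrD2r ltr_pdivrMr //.
  apply: le_lt_trans varM _.
  rewrite -subr_gt0.
  have -> : beta * M * (beta * M) - beta ^+ 3 / 4 * M ^+ 2 = (beta * M) ^+ 2 * (1 - beta / 4).
    by field.
  rewrite mulr_gt0 ?exprn_gt0 // subr_gt0 ltr_pdivrMr // mul1r.
  by apply: lt_trans b1 _; rewrite ltr1n.
have N0 : N != 0 by apply: contraTneq Mp => N0; rewrite /M N0 mul0r ltxx.
pose E := [pred X : {ffun 'I_s -> 'I_m} | ~~ (beta * M <= `|#|hit_pairs h X|%:R - M|)].
have -> : @prob s m R (fun fl => `| W%:R - @est V s m R es fl | < beta * W%:R) =
    @prob s m R (fun fl => E (final_index m_gt0 fl)).
  apply: eq_bigl => fl; rewrite /= -ltNge.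
  rewrite /est (Wset_final m_gt0) -card_slot_pairs [(2 * _)%:R]natrM -/N natrX.
  set Y := #|_|%:R.
  (* Since [W] is [M] rescaled just as [est] rescales [Y], error and threshold both carry the factor
     m^2/(2N). *)
  have -> : W%:R - m%:R ^+ 2 * Y / (2 * N) = (M - Y) * (m%:R ^+ 2 / (2 * N)).
    by rewrite /M edge_density_wedge; field; rewrite N0 m0.
  have k0 : 0 < m%:R ^+ 2 / (2 * N).
    have Np : 0 < N by rewrite lt_def N0 ler0n.
    by rewrite divr_gt0 ?(mulr_gt0 _ Np) ?exprn_gt0 ?ltr0n.
  have -> : beta * W%:R = beta * M * (m%:R ^+ 2 / (2 * N)).
    by rewrite /M edge_density_wedge; field; rewrite N0 m0.
  by rewrite normrM [X in _ * X]gtr0_norm // ltr_pM2r // distrC.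
rewrite prob_avg.
have -> : avg (fun X => (E X)%:R) =
    1 - avg (fun X : {ffun 'I_s -> 'I_m} => (beta * M <= `|#|hit_pairs h X|%:R - M|)%R%:R) :> R.
  rewrite -[X in X - _](@avg_const R 'I_s 'I_m T0) -avgB.
  by apply: eq_avg => X /=; case: (_ <= _); rewrite ?subrr ?subr0.
(* The failure probability is at most (beta^3/4) M^2 / (beta M)^2 = beta/4. *)
rewrite ltrD2l ltrN2; apply: le_lt_trans (second_moment_tail _ bM) _.
rewrite ltr_pdivrMr ?exprn_gt0 //; apply: le_lt_trans varM _.
rewrite -subr_gt0.
have -> : beta * (beta * M) ^+ 2 - beta ^+ 3 / 4 * M ^+ 2 = beta ^+ 3 * M ^+ 2 * (3 / 4) by field.
by apply: mulr_gt0; [rewrite mulr_gt0 ?exprn_gt0 | rewrite divr_gt0 ?ltr0n].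
Qed.

End Main.

Theorem mainTheorem1 :
  exists c : rat, 0 < c /\
  forall (R : rcfType) (V : finType) (es : seq {set V}) (s : nat) (beta : R),
    uniq es ->
    all (fun e : {set V} => #|e| == 2%N) es ->
    (1 <= ntri es)%N ->
    (size es <= nwedges es)%N ->
    0 < beta -> beta < 1 ->
    ratr c * (size es)%:R / (beta ^+ 3 * Num.sqrt (ntri es)%:R) <= s%:R ->
    let m := size es in
    let kappa : R := 3 * (ntri es)%:R / (nwedges es)%:R in
    `| kappa / 3 - @expect_bm V s m R es | < beta /\
    1 - beta < @prob s (size es) R
        (fun fl : flips s m =>
           `| (nwedges es)%:R - @est V s (size es) R es fl | < beta * (nwedges es)%:R).
Proof.
exists 1000; split=> // R V es s beta es_uniq es_edges tri1 _ b0 b1.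
rewrite ratr_nat => s_large m kappa; apply: single_bit_bounds => //.
(* An empty stream has no pair of positions, hence no triangle. *)
rewrite lt0n; apply: contraTneq tri1 => m0.
rewrite -ltnNge ltnS leqn0 ntri_future_closed //; apply/eqP/eq_card0 => -[[x xm] y].
by exfalso; rewrite m0 in xm.
Qed.
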